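(* Let $(\Gamma,\mu)$ be a weighted graph satisfying $(p_0)$ (there is $p_0>0$ with $\mu_{x,y}/\mu(x)\ge p_0$ for all adjacent $x\sim y$) and the elliptic Harnack inequality $(H)$ (there is $H>1$ such that for all $x\in\Gamma$, $R>0$ and every non-negative function $u$ harmonic in $B(x,2R)$, $\max_{B(x,R)}u\le H\min_{B(x,R)}u$). Then there is a constant $C_2>1$ such that for all $x\in\Gamma$ and $R>0$ $$\rho(x,R,4R)\le C_2\,\rho(x,2R,4R).$$ If in addition the bounded covering condition $(BC)$ holds (there is an integer $K$ such that for all $x\in\Gamma$, $R>0$ the ball $B(x,2R)$ can be covered by at most $K$ balls of radius $R$), then there is a constant $C_1>1$ such that for all $x\in\Gamma$ and $R>0$ $$\rho(x,R,4R)\le C_1\,\rho(x,R,2R).$$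
   Context: $\Gamma$ is a countably infinite connected graph ($x\sim y$ denotes adjacency) with weights $\mu_{x,y}=\mu_{y,x}>0$ on its edges ($\mu_{x,y}=0$ if $x\not\sim y$); $\mu(x)=\sum_{y\sim x}\mu_{x,y}$. $P(x,y)=\mu_{x,y}/\mu(x)$, $Pf(x)=\sum_yP(x,y)f(y)$, $\Delta=P-I$, $(f,g)_\mu=\sum_x f(x)g(x)\mu(x)$. $d$ is the shortest-path distance and $B(x,R)=\{y: d(x,y)<R\}$. For $A\subset\Gamma$, $\overline{A}$ is $A$ together with all vertices adjacent to a vertex of $A$; a function $h$ is harmonic on $A$ if it is defined on $\overline{A}$ and $Ph(x)=h(x)$ for all $x\in A$ (non-negativity is required on $\overline{A}$). The resistance between disjoint sets $A,B$ is $\rho(A,B)=\left(\inf\{(-\Delta f,f)_\mu: f|_A=1,\ f|_B=0\}\right)^{-1}$, where $(-\Delta f,f)_\mu=\frac12\sum_{x,y}\mu_{x,y}(f(x)-f(y))^2$; and $\rho(x,r,R)=\rho(B(x,r),\Gamma\setminus B(x,R))$. *)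

(* Defs.v *)
From HB Require Import structures.
From mathcomp Require Import all_boot all_order all_algebra.
From mathcomp Require Import all_classical all_reals all_analysis.

Set Implicit Arguments.
Unset Strict Implicit.
Unset Printing Implicit Defensive.

Import Order.TTheory GRing.Theory Num.Theory.

Local Open Scope classical_set_scope.
Local Open Scope ring_scope.

(* Countability is carried by the vertex type.  Loops are not excluded; they
   affect neither distances nor the Dirichlet energy. *)
Record weighted_graph (R : realType) (V : countType) := WeightedGraph {
  adj : rel V;
  wt : V -> V -> R;
  vertices_infinite : infinite_set [set: V];
  adj_sym : symmetric adj;
  adj_connected : forall x y, exists p, path adj x p /\ last x p = y;
  wt_sym : forall x y, wt x y = wt y x;
  wt_gt0 : forall x y, adj x y -> 0 < wt x y;
  wt_eq0 : forall x y, ~~ adj x y -> wt x y = 0 }.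

Section WeightedGraph.
Context {R : realType} {V : countType} (G : weighted_graph R V).
Implicit Types (x y : V) (A B : set V) (f u : V -> R) (r : R).

(* Sums over [i \in A] have value 0 when the support is infinite.  They are only
   used under [cond_p0], where every vertex has finitely many neighbours: see
   [cond_p0_locally_finite]. *)
Definition vmeas x : R := \sum_(y \in [set y | adj G x y]) wt G x y.

Definition tprob x y : R := wt G x y / vmeas x.

Definition markov_op f x : R := \sum_(y \in [set: V]) tprob x y * f y.

Definition walk x y (n : nat) : Prop :=
  exists p, [/\ path (adj G) x p, last x p = y & size p = n].

Lemma walk_exists x y : exists n, `[< walk x y n >].
Proof.
have [p [xp <-]] := adj_connected G x y.
by exists (size p); apply/asboolP; exists p.
Qed.

Definition gdist x y : nat := ex_minn (walk_exists x y).

Definition gball x r : set V := [set y | (gdist x y)%:R < r].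

Definition vclosure A : set V := A `|` [set y | exists2 x, A x & adj G x y].

(* For x in A, [markov_op u x] only depends on the values of u on
   [vclosure A]; the values of u elsewhere are irrelevant. *)
Definition harmonic_on A u : Prop := forall x, A x -> markov_op u x = u x.

(* (-Delta f, f)_mu *)
Definition energy f : \bar R :=
  ((2^-1)%:E *
   \esum_(p in [set: V * V]) (wt G p.1 p.2 * (f p.1 - f p.2) ^+ 2)%:E)%E.

Definition potentials A B : set (V -> R) :=
  [set f | (forall x, A x -> f x = 1) /\ (forall x, B x -> f x = 0)].

(* In \bar R, 0^-1 = +oo and +oo^-1 = 0. *)
Definition resistance A B : \bar R :=
  ((ereal_inf [set energy f | f in potentials A B])^-1)%E.

Definition rho x r s : \bar R := resistance (gball x r) (~` gball x s).

Definition cond_p0 : Prop :=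
  exists2 p0 : R, 0 < p0 & forall x y, adj G x y -> p0 <= wt G x y / vmeas x.

(* Maximum and minimum over a ball are taken in \bar R, where they need no
   boundedness proviso; balls are finite under [cond_p0]. *)
Definition elliptic_harnack : Prop :=
  exists2 H : R, 1 < H &
    forall x r u, 0 < r ->
      (forall y, vclosure (gball x (2 * r)) y -> 0 <= u y) ->
      harmonic_on (gball x (2 * r)) u ->
      (ereal_sup [set (u y)%:E | y in gball x r]
       <= H%:E * ereal_inf [set (u y)%:E | y in gball x r])%E.

Definition bounded_covering : Prop :=
  exists K : nat, forall x r, 0 < r ->
    exists2 s : seq V, (size s <= K)%N &
      gball x (2 * r) `<=` [set y | exists2 z, z \in s & gball z r y].

Lemma cond_p0_locally_finite :
  cond_p0 -> forall x, finite_set [set y | adj G x y].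
Proof.
move=> [p0 p0_gt0 hp0] x; apply: contrapT => infN.
have m0 : vmeas x = 0.
  rewrite /vmeas no_finite_support ?big_nil// => fin; apply: infN.
  apply: sub_finite_set fin => y /= xy; split=> //=.
  by apply/eqP; rewrite gt_eqF// wt_gt0.
have [y xy] : exists y, adj G x y.
  apply: contrapT => noy; apply: infN.
  by rewrite (_ : [set y | _] = set0)// -subset0 => y xy; apply: noy; exists y.
by have := hp0 _ _ xy; rewrite m0 invr0 mulr0 leNgt p0_gt0.
Qed.

End WeightedGraph.

(* Main.v *)
(* Write [Cap(X,D)] for the inverse of the resistance between [X] and the
   complement of the finite set [D].  If [g] is the Green function of [D] with pole
   [x] in [X] and [e] the equilibrium measure of [X] in [D], then [sum g e = 1],
   where [e] has total mass [Cap(X,D)] and lives on the inner boundary of [X]; so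
   [1/Cap(X,D)] lies between the extrema of [g] there.

   For the first inequality, with [D = B(x,4R)], it remains to compare [g] on the
   inner boundaries of [B(x,R)] and [B(x,2R)].  No chain of balls around an
   annulus is available; instead Harnack chains along geodesics are combined with
   the symmetry [g_x(y) = g_y(x)] ([green_annulus]).

   For the second inequality, let [u] be harmonic in [B(x,2R)] and equal outside
   to the probability of leaving [B(x,4R)] before hitting [B(x,R)].  Green's
   formula gives [Cap(B(x,R),B(x,4R)) >= min_{B(x,R)} u * Cap(B(x,R),B(x,2R))].  By
   Harnack, a lower bound for [u] at one point [m] of [B(x,2R)] suffices, and it
   comes from comparison with the Green function killed on [B(x,R)] whose pole lies
   outside [B(x,4R)].

   Radii below 256 are handled with [cond_p0] alone. *)
Require Import Defs.
From mathcomp Require Import all_boot all_order all_algebra finmap.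
From mathcomp Require Import all_classical all_reals all_analysis.
From mathcomp Require Import zify ring lra.

Set Implicit Arguments.
Unset Strict Implicit.
Unset Printing Implicit Defensive.

Import Order.TTheory GRing.Theory Num.Theory.

Local Open Scope classical_set_scope.
Local Open Scope ring_scope.

(** * Graph distance *)

Section Distance.
Context {R : realType} {V : countType} (G : weighted_graph R V).
Implicit Types (x y a b c : V) (n t : nat).
Local Notation d := (gdist G).

Lemma gdist_walk x y : walk G x y (d x y).
Proof. by rewrite /gdist; case: ex_minnP => n /asboolP. Qed.

Lemma gdist_le_walk x y n : walk G x y n -> (d x y <= n)%N.
Proof. by move=> w; rewrite /gdist; case: ex_minnP => m _; apply; apply/asboolP. Qed.

Lemma walk_cat x y z m n : walk G x y m -> walk G y z n -> walk G x z (m + n).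
Proof.
move=> [p [xp <- <-]] [q [yq <- <-]]; exists (p ++ q).
by rewrite cat_path xp yq last_cat size_cat.
Qed.

Lemma walk_sym x y n : walk G x y n -> walk G y x n.
Proof.
move=> [p [+ <- <-]]; elim: p x => [|a p IH] x /=; first by exists [::].
case/andP=> xa /IH wa; rewrite -addn1; apply: walk_cat wa _.
by exists [:: x]; rewrite /= adj_sym xa.
Qed.

Lemma gdistC x y : d x y = d y x.
Proof.
by apply/eqP; rewrite eqn_leq !gdist_le_walk//; apply/walk_sym/gdist_walk.
Qed.

Lemma gdist_triangle y x z : (d x z <= d x y + d y z)%N.
Proof. by apply/gdist_le_walk/walk_cat; apply: gdist_walk. Qed.

Lemma gdistxx x : d x x = 0%N.
Proof. by apply/eqP; rewrite -leqn0 gdist_le_walk//; exists [::]. Qed.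

Lemma gdist0_eq x y : d x y = 0%N -> x = y.
Proof. by move=> e; have := gdist_walk x y; rewrite e => -[[|? ?] [_ <-]]. Qed.

Lemma gdist_adj x y : adj G x y -> (d x y <= 1)%N.
Proof. by move=> xy; apply: gdist_le_walk; exists [:: y]; rewrite /= xy. Qed.

Lemma gdist1_adj x y : d x y = 1%N -> adj G x y.
Proof.
move=> e; have := gdist_walk x y; rewrite e => -[[|a [|? ?]]] [//= + <-] _.
by rewrite andbT.
Qed.

(** Cutting a shortest walk after [t] steps bounds the lengths of both pieces; the triangle
    inequality turns these bounds into equalities. *)
Lemma gdist_split t x y : (t <= d x y)%N ->
  exists c, d x c = t /\ (d x c + d c y = d x y)%N.
Proof.
move=> le_t; have [p [xp ly sp]] := gdist_walk x y.
pose c := last x (take t p); exists c.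
move: xp; rewrite -{1}(cat_take_drop t p) cat_path -/c => /andP[xc cy].
have le1 : (d x c <= t)%N.
  by apply: gdist_le_walk; exists (take t p); split=> //; rewrite size_takel ?sp.
have le2 : (d c y <= d x y - t)%N.
  apply: gdist_le_walk; exists (drop t p); split=> //; last by rewrite size_drop sp.
  by rewrite -ly -{2}(cat_take_drop t p) last_cat.
have := gdist_triangle c x y; lia.
Qed.

Lemma gdist_ind (P : V -> Prop) x y :
  P x -> (forall a b, adj G a b -> P a -> P b) -> P y.
Proof.
move=> Px step; have [p [+ <-]] := adj_connected G x y.
elim: p x Px => [//|a p IH] x Px /= /andP[xa ap]; apply: IH ap.
exact: step xa Px.
Qed.

Context (hp0 : cond_p0 G).

Lemma nball_finite x n : finite_set [set y | (d x y <= n)%N].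
Proof.
elim: n => [|n IH].
  apply: sub_finite_set (finite_set1 x) => y /=.
  by rewrite leqn0 => /eqP /gdist0_eq ->.
have fU : finite_set (\bigcup_(z in [set y | (d x y <= n)%N]) [set y | adj G z y]).
  by apply: bigcup_finite => // z _; apply: cond_p0_locally_finite.
apply: (@sub_finite_set _ _ ([set y | (d x y <= n)%N] `|`
   \bigcup_(z in [set y | (d x y <= n)%N]) [set y | adj G z y])); last first.
  by rewrite finite_setU.
move=> y /= yn; case: (leqP (d x y) n) => [|lt]; [by left|right].
have [c [xc e]] := gdist_split (ltnW lt); exists c => /=; first by rewrite xc.
by apply: gdist1_adj; lia.
Qed.

Lemma gball_nball x (r : R) : exists n, gball G x r `<=` [set y | (d x y <= n)%N].
Proof.
exists (Num.Def.truncn `|r|) => y /= yr; rewrite truncn_ge_nat//.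
by apply: le_trans (ler_norm r); apply: ltW.
Qed.

Lemma gball_finite x (r : R) : finite_set (gball G x r).
Proof.
by have [n sub] := gball_nball x r; apply: sub_finite_set sub (nball_finite x n).
Qed.

(** Balls are finite and the vertex set is not, so some vertex has distance at least [n]; a geodesic
    to it passes through distance exactly [n]. *)
Lemma exists_gdist x n : exists y, d x y = n.
Proof.
have [y /= ny] : exists y, (n <= d x y)%N.
  apply: contrapT => no; apply: (vertices_infinite G).
  apply: sub_finite_set (nball_finite x n) => y _ /=.
  by rewrite leqNgt; apply/negP => /ltnW lt; apply: no; exists y.
by have [c [<- _]] := gdist_split ny; exists c.
Qed.

End Distance.

(** * Laplacian and Dirichlet problem *)

Section Laplacian.
Context {R : realType} {V : countType} (G : weighted_graph R V).
Implicit Types (x y a b c : V) (D S T : {fset V}) (u f g : V -> R).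

Definition nbrs x : {fset V} := fset_set [set y | adj G x y].

(* [lap u x] is [- mu(x) * Delta u(x)]; this normalisation makes [lap]
   symmetric for the counting measure. *)
Definition lap u x : R := \sum_(y <- nbrs x) wt G x y * (u x - u y).

Lemma eq_lap u g x : u =1 g -> lap u x = lap g x.
Proof. by move=> e; apply: eq_bigr => y _; rewrite !e. Qed.

Lemma lap_comb (t : R) u g x :
  lap (fun z => u z + t * g z) x = lap u x + t * lap g x.
Proof. by rewrite /lap mulr_sumr -big_split; apply: eq_bigr => y _ /=; ring. Qed.

Lemma lapB u g x : lap (fun z => u z - g z) x = lap u x - lap g x.
Proof.
rewrite -mulN1r -lap_comb; apply: eq_lap => z; ring.
Qed.

Lemma lap_compl (t : R) u x : lap (fun z => t - u z) x = - lap u x.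
Proof. by rewrite /lap -sumrN; apply: eq_bigr => y _; ring. Qed.

Lemma lap_const (t : R) x : lap (fun=> t) x = 0.
Proof. by rewrite /lap big1// => y _; rewrite subrr mulr0. Qed.

Lemma lapZ (t : R) u x : lap (fun z => t * u z) x = t * lap u x.
Proof. by rewrite /lap mulr_sumr; apply: eq_bigr => y _; ring. Qed.

Context (hp0 : cond_p0 G).

Lemma mem_nbrs x y : (y \in nbrs x) = adj G x y.
Proof. by rewrite in_fset_set ?mem_setE//; apply: cond_p0_locally_finite. Qed.

Lemma lap_sum T u x : (forall y, adj G x y -> y \in T) ->
  \sum_(y <- T) wt G x y * (u x - u y) = lap u x.
Proof.
move=> sub; apply/esym/big_fset_incl.
  by apply/fsubsetP => y; rewrite mem_nbrs; apply: sub.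
by move=> y _; rewrite mem_nbrs => /(wt_eq0 (w := G)) ->; rewrite mul0r.
Qed.

Lemma wt_ge0 x y : 0 <= wt G x y.
Proof.
by case: (boolP (adj G x y)) => [/wt_gt0/ltW//|/wt_eq0->].
Qed.

Lemma vmeasE x : vmeas G x = \sum_(y <- nbrs x) wt G x y.
Proof. by rewrite /vmeas fsbig_finite//; apply: cond_p0_locally_finite. Qed.

Lemma exists_adj x : exists y, adj G x y.
Proof. by have [y /gdist1_adj] := exists_gdist hp0 x 1; exists y. Qed.

Lemma wt_le_vmeas x y : wt G x y <= vmeas G x.
Proof.
case: (boolP (adj G x y)) => [xy|/wt_eq0->].
  rewrite vmeasE (big_rem y) ?mem_nbrs//= lerDl.
  by apply: sumr_ge0 => z _; apply: wt_ge0.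
by rewrite vmeasE sumr_ge0// => z _; apply: wt_ge0.
Qed.

Lemma vmeas_gt0 x : 0 < vmeas G x.
Proof.
by have [y xy] := exists_adj x; apply: lt_le_trans (wt_le_vmeas x y); apply: wt_gt0.
Qed.

Lemma lapE u x : lap u x = vmeas G x * u x - \sum_(y <- nbrs x) wt G x y * u y.
Proof.
by rewrite vmeasE mulr_suml -sumrB; apply: eq_bigr => y _; rewrite mulrBr.
Qed.

Lemma lap_markov u x : lap u x = vmeas G x * (u x - markov_op G u x).
Proof.
rewrite lapE mulrBr; congr (_ - _).
rewrite /markov_op -(fsbig_widen [set` nbrs x] setT)//; last first.
  move=> y /= [_ /negP]; rewrite mem_nbrs => /(wt_eq0 (w := G)).
  by rewrite /tprob => ->; rewrite !mul0r.
rewrite -fsbig_seq// mulr_sumr; apply: eq_bigr => y _.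
by rewrite /tprob mulrA mulrCA divff ?mulr1 ?gt_eqF ?vmeas_gt0.
Qed.

Lemma harmonic_lap (A : set V) u :
  (forall x, A x -> lap u x = 0) -> harmonic_on G A u.
Proof.
move=> h x /h /eqP; rewrite lap_markov mulf_eq0 gt_eqF ?vmeas_gt0//= subr_eq0.
by move=> /eqP.
Qed.

Lemma lap_locally_const u x : (forall y, adj G x y -> u y = u x) -> lap u x = 0.
Proof.
move=> h; rewrite /lap big_seq big1// => y.
by rewrite mem_nbrs => /h ->; rewrite subrr mulr0.
Qed.

(** At a global minimum every term of [lap u b] is at most [0], so a non-negative sum forces each of
    them to vanish. *)
Lemma eq_min_adj u b : 0 <= lap u b -> (forall y, u b <= u y) ->
  forall c, adj G b c -> u c = u b.
Proof.
move=> + ub c bc.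
rewrite /lap (big_rem c) ?mem_nbrs//=.
set s := (X in _ + X) => le0.
have s0 : s <= 0.
  by apply: sumr_le0 => y _; rewrite mulr_ge0_le0 ?wt_ge0// subr_le0.
have : 0 <= wt G b c * (u b - u c) by lra.
by rewrite pmulr_rge0 ?wt_gt0// subr_ge0 => ?; apply/le_anti/andP.
Qed.

Lemma fset_argmin D u x : x \in D ->
  exists2 a, a \in D & forall b, b \in D -> u a <= u b.
Proof.
move=> xD.
case: (@Order.TotalTheory.arg_minP _ R D [` xD]%fset xpredT (u \o val) isT).
move=> a _ amin; exists (val a); first exact: valP.
by move=> b bD; apply: (amin [` bD]%fset).
Qed.

(** A negative minimum would be attained in [D] and spread along edges to the whole connected graph,
    placing the infinite vertex set inside [D]. *)
Lemma min_principle D u : (forall x, x \in D -> 0 <= lap u x) ->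
  (forall x, x \notin D -> 0 <= u x) -> forall x, 0 <= u x.
Proof.
move=> hD hu x; rewrite leNgt; apply/negP => ux.
have inD y : u y < 0 -> y \in D.
  by apply: contraTT => /hu; rewrite leNgt.
have [a aD amin] := fset_argmin u (inD _ ux).
have ua : u a < 0 by exact: le_lt_trans (amin _ (inD _ ux)) ux.
have aall y : u a <= u y.
  case: (boolP (y \in D)) => [/amin//|/hu uy]; exact: le_trans (ltW ua) uy.
have ae y : u y = u a.
  apply: (@gdist_ind _ _ G (fun z => u z = u a) a y) => // b c bc ub.
  rewrite -ub; apply: eq_min_adj bc => [|z]; last by rewrite ub.
  by apply/hD/inD; rewrite ub.
have := vertices_infinite G; apply; apply: sub_finite_set (finite_fset D) => y _ /=.
by apply: inD; rewrite ae.
Qed.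

Lemma comparison D u g : (forall x, x \in D -> lap u x <= lap g x) ->
  (forall x, x \notin D -> u x <= g x) -> forall x, u x <= g x.
Proof.
move=> h1 h2 x; rewrite -subr_ge0.
apply: (min_principle (D := D) (u := fun z => g z - u z)) => z zD.
  by rewrite lapB subr_ge0 h1.
by rewrite subr_ge0 h2.
Qed.

(** Replacing [u] by [g] beyond the neighbours of [D] leaves [lap u] on [D] unchanged, so only the
    boundary values of [u] matter. *)
Lemma comparison_closure D u g :
  (forall x, x \in D -> lap u x <= lap g x) ->
  (forall x y, x \in D -> adj G x y -> y \notin D -> u y <= g y) ->
  forall x, x \in D -> u x <= g x.
Proof.
move=> hD hb.
pose u' x := if (x \in D) || `[< exists2 y, y \in D & adj G y x >] then u x else g x.
have u'D x : x \in D -> u' x = u x by move=> xD; rewrite /u' xD.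
suff le x : u' x <= g x by move=> x xD; rewrite -u'D.
apply: (comparison (D := D)) => y yD.
  rewrite (_ : lap u' y = lap u y) ?hD// /lap; apply: eq_big_seq => z.
  rewrite mem_nbrs => yz; rewrite u'D// /u' (_ : `[< _ >]) ?orbT//.
  by apply/asboolP; exists y.
rewrite /u' (negPf yD) /=; case: asboolP => // -[z zD zy].
exact: hb zD zy yD.
Qed.

(* Induction on [D]: to add [a], correct the solution on [D] by a multiple of the
   [h] harmonic on [D] with boundary data [1] at [a]; [lap h a != 0] by the
   minimum principle. *)
Lemma dirichlet_exists D (phi s : V -> R) : exists u,
  (forall x, x \notin D -> u x = phi x) /\ (forall x, x \in D -> lap u x = s x).
Proof.
elim/fset1U_rect: D phi s => [|a D aD IH] phi s.
  by exists phi; split=> // x; rewrite inE.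
have [u0 [u0o u0i]] := IH (fun z => if z == a then 0 else phi z) s.
have [h [ho hi]] := IH (fun z => (z == a)%:R) (fun=> 0).
have ha : h a = 1 by rewrite ho// eqxx.
have lh : lap h a != 0.
  apply/eqP => lh0.
  suff h0 x : h x <= 0 by have := h0 a; rewrite ha ler10.
  apply: (comparison (D := (a |` D)%fset) (g := fun=> 0)) => y.
    by rewrite lap_const !inE => /orP[/eqP->|/hi->//]; rewrite lh0.
  by rewrite !inE negb_or => /andP[/negPf ya /ho ->]; rewrite ya.
pose t := (s a - lap u0 a) / lap h a.
exists (fun z => u0 z + t * h z); split=> x; rewrite !inE.
  rewrite negb_or => /andP[/negPf ya yD].
  by rewrite u0o// ho// ya mulr0 addr0.
case/orP => [/eqP->|xD]; rewrite lap_comb.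
  by rewrite /t divfK//; ring.
by rewrite u0i// hi// mulr0 addr0.
Qed.

(** Summation by parts: the left side is the double sum [W], and averaging [W] with its copy under
    the swap of [x] and [y] gives the right side. Since [T] contains [S] and its neighbours, no
    nonzero term of [lap g] on [S] is cut off. *)
Lemma green_identity S T f g :
  (forall x, x \notin S -> f x = 0) ->
  (forall x y, x \in S -> (y == x) || adj G x y -> y \in T) ->
  \sum_(x <- S) f x * lap g x =
  2^-1 * \sum_(x <- T) \sum_(y <- T) wt G x y * ((f x - f y) * (g x - g y)).
Proof.
move=> fS ST.
pose W := \sum_(x <- T) \sum_(y <- T) wt G x y * (f x * (g x - g y)).
have WE : W = \sum_(x <- S) f x * lap g x.
  rewrite /W; symmetry.
  transitivity (\sum_(x <- T) f x * \sum_(y <- T) wt G x y * (g x - g y)).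
    have sub : (S `<=` T)%fset by apply/fsubsetP => x xS; apply: (ST x); rewrite ?eqxx.
    rewrite -(big_fset_incl _ sub); last by move=> x _ /fS ->; rewrite mul0r.
    rewrite [LHS]big_seq [RHS]big_seq; apply: eq_bigr => x xS; rewrite lap_sum// => y xy.
    by apply: (ST x) => //; rewrite xy orbT.
  apply: eq_bigr => x _; rewrite mulr_sumr; apply: eq_bigr => y _; ring.
have WE' : W = \sum_(x <- T) \sum_(y <- T) wt G x y * (f y * (g y - g x)).
  rewrite /W exchange_big /=; apply: eq_bigr => x _; apply: eq_bigr => y _.
  by rewrite (wt_sym G).
have -> : \sum_(x <- T) \sum_(y <- T) wt G x y * ((f x - f y) * (g x - g y)) = W + W.
  rewrite {2}WE' /W -big_split; apply: eq_bigr => x _ /=.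
  rewrite -big_split; apply: eq_bigr => y _ /=; ring.
by rewrite -WE -mulr2n -[W *+ 2]mulr_natl mulKf// pnatr_eq0.
Qed.

Lemma closed_superset S : exists T : {fset V},
  forall x y, x \in S -> (y == x) || adj G x y -> y \in T.
Proof.
elim/fset1U_rect: S => [|a S aS [T hT]]; first by exists fset0 => x y; rewrite inE.
exists (a |` (nbrs a `|` T))%fset => x y; rewrite !inE => /orP[/eqP->|xS].
  by case/orP => [->//|xy]; rewrite mem_nbrs xy !orbT.
by move=> /(hT _ _ xS) ->; rewrite !orbT.
Qed.

Lemma lap_selfadjoint S f g :
  (forall x, x \notin S -> f x = 0) -> (forall x, x \notin S -> g x = 0) ->
  \sum_(x <- S) f x * lap g x = \sum_(x <- S) g x * lap f x.
Proof.
move=> fS gS; have [T ST] := closed_superset S.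
rewrite (green_identity g fS ST) (green_identity f gS ST); congr (_ * _).
by apply: eq_bigr => x _; apply: eq_bigr => y _; rewrite [(f x - _) * _]mulrC.
Qed.

Lemma energy_sum S f : (forall x, x \notin S -> f x = 0) ->
  energy G f = (\sum_(x <- S) f x * lap f x)%:E.
Proof.
move=> fS; have [T ST] := closed_superset S.
rewrite (green_identity f fS ST) EFinM /energy; congr (_ * _)%E.
set F := (fun p : V * V => (wt G p.1 p.2 * (f p.1 - f p.2) ^+ 2)%:E).
pose TT := [seq (x, y) | x <- T, y <- T].
have memTT x y : ((x, y) \in TT) = (x \in T) && (y \in T)
  by apply/allpairsP/andP => [[[? ?] [? ? [-> ->]]]|[? ?]]; [|exists (x, y)].
transitivity (\esum_(p in [set` TT]) F p).
  rewrite [RHS]esum_mkcond; apply: eq_esum => -[x y] _; rewrite mem_setE.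
  case: ifPn => //; rewrite memTT => xyT.
  have [xy|nxy] := boolP (adj G x y); last first.
    by rewrite /F/= (wt_eq0 nxy) mul0r.
  (* An adjacent pair outside the square of [T] has no endpoint in [S], so [f] vanishes at both
     ends. *)
  have xS : x \notin S.
    apply: contra xyT => xS; rewrite (ST x x) ?eqxx//=.
    by apply: (ST x y) => //; rewrite xy orbT.
  have yS : y \notin S.
    apply: contra xyT => yS; rewrite (ST y y) ?eqxx// andbT.
    by apply: (ST y x) => //; rewrite adj_sym xy orbT.
  by rewrite /F /= !fS// subrr expr0n mulr0.
rewrite esum_fset; last 2 first.
- exact: finite_seq.
- by move=> p _; rewrite lee_fin mulr_ge0 ?sqr_ge0 ?wt_ge0.
rewrite -fsbig_seq; last by apply: allpairs_uniq; rewrite ?fset_uniq // => -[? ?] [? ?].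
by rewrite sumEFin big_allpairs.
Qed.

End Laplacian.

(** * Capacities and Green functions *)

Section Capacity.
Context {R : realType} {V : countType} (G : weighted_graph R V).
Context (hp0 : cond_p0 G).
Implicit Types (p q x y : V) (D X : {fset V}) (u f g phi s : V -> R) (m M : R).
Local Notation lap := (lap G).

Definition dirichlet_sol D phi s : V -> R :=
  sval (cid (dirichlet_exists hp0 D phi s)).

Lemma dirichlet_sol_out D phi s x :
  x \notin D -> dirichlet_sol D phi s x = phi x.
Proof. by rewrite /dirichlet_sol; case: cid => u [h ?] /= /h. Qed.

Lemma lap_dirichlet_sol D phi s x :
  x \in D -> lap (dirichlet_sol D phi s) x = s x.
Proof. by rewrite /dirichlet_sol; case: cid => u [? h] /= /h. Qed.

(** The equilibrium potential: for [X] inside [D], the probability of hitting [X] before leaving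
    [D]. Its [lap] on [D] is the equilibrium measure. *)
Definition equil X D := dirichlet_sol (D `\` X)%fset (fun x => (x \in X)%:R) (fun=> 0).

Definition capacity X D := \sum_(x <- D) lap (equil X D) x.

Lemma equil1 X D x : x \in X -> equil X D x = 1.
Proof. by move=> xX; rewrite /equil dirichlet_sol_out ?inE ?xX. Qed.

Lemma equil_lap0 X D x : x \in D -> x \notin X -> lap (equil X D) x = 0.
Proof. by move=> xD xX; rewrite lap_dirichlet_sol// !inE xX. Qed.

Lemma equil_ge0 X D x : 0 <= equil X D x.
Proof.
apply: (min_principle hp0 (D := (D `\` X)%fset)) => y yDX.
  by rewrite lap_dirichlet_sol.
by rewrite /equil dirichlet_sol_out.
Qed.

Lemma equil_le1 X D x : equil X D x <= 1.
Proof.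
apply: (comparison hp0 (D := (D `\` X)%fset) (g := fun=> 1)) => y yDX.
  by rewrite lap_dirichlet_sol// lap_const.
by rewrite /equil dirichlet_sol_out// lern1 leq_b1.
Qed.

Lemma lap_equil_ge0 X D x : x \in X -> 0 <= lap (equil X D) x.
Proof.
move=> xX; apply: sumr_ge0 => y _; rewrite mulr_ge0 ?wt_ge0//.
by rewrite subr_ge0 (equil1 D xX) equil_le1.
Qed.

Lemma lap_equil_interior X D x : x \in X -> (forall y, adj G x y -> y \in X) ->
  lap (equil X D) x = 0.
Proof.
move=> xX sub; apply: lap_locally_const => // y /sub yX.
by rewrite !equil1.
Qed.

Section Inclusion.
Context (X D : {fset V}) (XD : (X `<=` D)%fset).
Local Notation e := (equil X D).

Lemma equil0 x : x \notin D -> e x = 0.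
Proof.
move=> xD; rewrite /equil dirichlet_sol_out ?inE ?(negPf xD) ?andbF//.
by have /negPf -> := contra (fsubsetP XD x) xD.
Qed.

Lemma capacity_sum : capacity X D = \sum_(x <- X) lap e x.
Proof.
by apply/esym/big_fset_incl => // x xD xX; rewrite equil_lap0.
Qed.

Lemma sum_equil f : (forall x, x \in X -> f x = 1) ->
  \sum_(x <- D) f x * lap e x = capacity X D.
Proof.
move=> f1; rewrite /capacity [LHS]big_seq [RHS]big_seq; apply: eq_bigr => x xD.
have [xX|xX] := boolP (x \in X); first by rewrite f1// mul1r.
by rewrite equil_lap0// mulr0.
Qed.

Lemma capacity_ge0 : 0 <= capacity X D.
Proof.
by rewrite capacity_sum big_seq; apply: sumr_ge0 => x; apply: lap_equil_ge0.
Qed.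

(** With zero total mass [e] would be harmonic in [D] and zero outside, hence at most [0], against
    its value [1] at [x]. *)
Lemma capacity_gt0 x : x \in X -> 0 < capacity X D.
Proof.
move=> xX; rewrite lt_neqAle capacity_ge0 andbT eq_sym capacity_sum big_seq.
rewrite psumr_eq0 => [|y]; last exact: lap_equil_ge0.
apply/negP => /allP /= c0.
suff : e x <= 0 by rewrite equil1// ler10.
apply: (comparison hp0 (D := D) (g := fun=> 0)) => y yD; last by rewrite equil0.
rewrite lap_const; have [yX|yX] := boolP (y \in X); last by rewrite equil_lap0.
by have := c0 y yX; rewrite yX => /eqP ->.
Qed.

Lemma capacity_energy : energy G e = (capacity X D)%:E.
Proof.
rewrite (energy_sum hp0 (S := D)); last exact: equil0.
by rewrite sum_equil//; apply: equil1.
Qed.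

(** Dirichlet principle: in [f = e + h] the part [h] vanishes on [X] and off [D], while [lap e]
    lives on [X] within [D]; so the cross terms vanish and the energy of [h] is a non-negative
    surplus. *)
Lemma capacity_min f : potentials [set` X] (~` [set` D]) f ->
  ((capacity X D)%:E <= energy G f)%E.
Proof.
move=> [f1 f0].
have f0' x : x \notin D -> f x = 0 by move=> xD; apply: f0; apply/negP.
rewrite (energy_sum hp0 f0') lee_fin.
pose h x := f x - e x.
have h0 x : x \notin D -> h x = 0 by move=> xD; rewrite /h f0'// equil0// subrr.
have he : \sum_(x <- D) h x * lap e x = 0.
  rewrite big_seq big1// => x xD; have [xX|xX] := boolP (x \in X).
    by rewrite /h f1// equil1// subrr mul0r.
  by rewrite equil_lap0// mulr0.
have eh : \sum_(x <- D) e x * lap h x = 0.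
  by rewrite (lap_selfadjoint hp0 (S := D))//; apply: equil0.
have hh : 0 <= \sum_(x <- D) h x * lap h x.
  have [T DT] := closed_superset hp0 D.
  rewrite (green_identity hp0 h h0 DT) mulr_ge0//.
  apply: sumr_ge0 => x _; apply: sumr_ge0 => y _.
  by rewrite mulr_ge0 ?wt_ge0// -expr2 sqr_ge0.
rewrite [leRHS](_ : _ = \sum_(x <- D) e x * lap e x + \sum_(x <- D) h x * lap e x
  + (\sum_(x <- D) e x * lap h x + \sum_(x <- D) h x * lap h x)); last first.
  rewrite -!big_split; apply: eq_bigr => x _ /=; rewrite lapB /h; ring.
by rewrite he eh addr0 add0r sum_equil ?lerDl//; apply: equil1.
Qed.

Lemma resistance_capacity x : x \in X ->
  resistance G [set` X] (~` [set` D]) = ((capacity X D)^-1)%:E.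
Proof.
move=> xX; rewrite /resistance.
rewrite (_ : ereal_inf _ = (capacity X D)%:E); last first.
  apply/eqP; rewrite eq_le; apply/andP; split.
    rewrite -capacity_energy; apply: ereal_inf_lbound; exists e => //; split.
      by move=> y; apply: equil1.
    by move=> y /negP; apply: equil0.
  by apply: le_ereal_inf_tmp => _ [f fP <-]; apply: capacity_min.
(* Positivity of the capacity matters here: the inverse of [0] in [\bar R] is [+oo]. *)
by rewrite inver gt_eqF// (capacity_gt0 xX).
Qed.

End Inclusion.

Definition green D p := dirichlet_sol D (fun=> 0) (fun x => (x == p)%:R).

Lemma green0 D p x : x \notin D -> green D p x = 0.
Proof. exact: dirichlet_sol_out. Qed.

Lemma lap_green D p x : x \in D -> lap (green D p) x = (x == p)%:R.
Proof. exact: lap_dirichlet_sol. Qed.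

Lemma green_ge0 D p x : 0 <= green D p x.
Proof.
apply: (min_principle hp0 (D := D)) => y yD; last by rewrite green0.
by rewrite lap_green.
Qed.

Lemma sum_green D p f : p \in D -> \sum_(x <- D) f x * lap (green D p) x = f p.
Proof.
move=> pD; rewrite (big_fsetD1 p)//= lap_green// eqxx mulr1 big_seq big1 ?addr0//.
by move=> x; rewrite !inE => /andP[/negPf xp xD]; rewrite lap_green// xp mulr0.
Qed.

Lemma green_sym D p q : p \in D -> q \in D -> green D p q = green D q p.
Proof.
move=> pD qD; rewrite -(sum_green (green D p) qD) -(sum_green (green D q) pD).
by rewrite (lap_selfadjoint hp0)// => x; apply: green0.
Qed.

(** Self-adjointness moves [lap] onto the Green function, where it becomes the point mass at [p]. *)
Lemma sum_green_equil X D p : (X `<=` D)%fset -> p \in X ->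
  \sum_(x <- D) green D p x * lap (equil X D) x = 1.
Proof.
move=> XD pX; have pD := fsubsetP XD _ pX.
rewrite (lap_selfadjoint hp0); [|exact: green0|exact: equil0].
by rewrite sum_green// equil1.
Qed.

Definition inner_boundary X x := x \in X /\ exists2 y, adj G x y & y \notin X.

Lemma lap_equil_boundary X D x : x \in D -> lap (equil X D) x != 0 ->
  inner_boundary X x.
Proof.
move=> xD nz; have [xX|xX] := boolP (x \in X); last by rewrite equil_lap0 ?eqxx in nz.
split=> //; apply: contrapT => no; move/eqP: nz; apply.
apply: lap_equil_interior => // y xy; apply/negPn/negP => yX; apply: no.
by exists y.
Qed.

Lemma green_capacity_le1 X D p m : (X `<=` D)%fset -> p \in X ->
  (forall x, inner_boundary X x -> m <= green D p x) -> m * capacity X D <= 1.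
Proof.
move=> XD pX hm; rewrite -(sum_green_equil XD pX) /capacity mulr_sumr.
rewrite big_seq [leRHS]big_seq; apply: ler_sum => x xD.
have [->|nz] := eqVneq (lap (equil X D) x) 0; first by rewrite !mulr0.
have bx := lap_equil_boundary xD nz.
by rewrite ler_wpM2r ?hm// lap_equil_ge0//; case: bx.
Qed.

Lemma green_capacity_ge1 X D p M : (X `<=` D)%fset -> p \in X ->
  (forall x, inner_boundary X x -> green D p x <= M) -> 1 <= M * capacity X D.
Proof.
move=> XD pX hM; rewrite -(sum_green_equil XD pX) /capacity mulr_sumr.
rewrite big_seq [leRHS]big_seq; apply: ler_sum => x xD.
have [->|nz] := eqVneq (lap (equil X D) x) 0; first by rewrite !mulr0.
have bx := lap_equil_boundary xD nz.
by rewrite ler_wpM2r ?hM// lap_equil_ge0//; case: bx.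
Qed.

(* With [w = u - (1 - e)], [e = equil X D] and [e' = equil X D'], Green's
   formula gives [cap X D = sum_X lap w = sum e' lap w = sum w lap e' =
   sum_X u lap e' >= c cap X D']. *)
Lemma capacity_compare X D D' u (c : R) : (X `<=` D')%fset -> (D' `<=` D)%fset ->
  (forall x, x \notin D' -> u x = 1 - equil X D x) ->
  (forall x, x \in D' -> lap u x = 0) ->
  (forall x, x \in X -> c <= u x) ->
  c * capacity X D' <= capacity X D.
Proof.
move=> XD' D'D uo ui uX; have XD := fsubset_trans XD' D'D.
pose w x := u x - (1 - equil X D x).
have wo x : x \notin D' -> w x = 0 by move=> /uo ux; rewrite /w ux subrr.
have lapw x : x \in D' -> lap w x = lap (equil X D) x.
  by move=> xD'; rewrite lapB lap_compl ui// sub0r opprK.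
have -> : capacity X D = \sum_(x <- D') equil X D' x * lap w x.
  rewrite capacity_sum//.
  rewrite -(big_fset_incl (A := X) _ XD') => [|x xD' xX]; last first.
    by rewrite lapw// equil_lap0 ?mulr0//; apply: (fsubsetP D'D).
  rewrite [LHS]big_seq [RHS]big_seq; apply: eq_bigr => x xX.
  by rewrite equil1// mul1r lapw//; apply: (fsubsetP XD').
rewrite (lap_selfadjoint hp0 _ wo); last exact: equil0.
rewrite /capacity mulr_sumr big_seq [leRHS]big_seq; apply: ler_sum => x xD'.
have [xX|xX] := boolP (x \in X); last by rewrite equil_lap0// !mulr0.
by rewrite ler_wpM2r ?lap_equil_ge0// /w equil1// subrr subr0 uX.
Qed.

End Capacity.

(** * Harnack chains *)

Section Harnack.
Context {R : realType} {V : countType} (G : weighted_graph R V).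
Context (hp0 : cond_p0 G).
Implicit Types (a b c w x y z : V) (u : V -> R) (e k n : nat).
Local Notation d := (gdist G).
Local Notation lap := (lap G).
Local Notation green := (green hp0).

Definition harnack_const (H : R) := forall c e u a b, (0 < e)%N ->
  (forall x, 0 <= u x) -> (forall x, (d c x <= 3 * e)%N -> lap u x = 0) ->
  (d c a <= e)%N -> (d c b <= e)%N -> u a <= H * u b.

(** The open ball of radius [e + 1] is the closed ball of radius [e]; the doubled open ball reaches
    distance [2 * e + 1], at most [3 * e] because [e] is positive. *)
Lemma elliptic_harnack_nat : elliptic_harnack G ->
  exists2 H : R, 1 < H & harnack_const H.
Proof.
move=> [H H1 hH]; exists H => // c e u a b e0 u0 hu ca cb.
have /(_ _) := hH c e.+1%:R u (ltr0Sn _ _) (fun y _ => u0 y).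
have hu' : harmonic_on G (gball G c (2 * e.+1%:R)) u.
  apply: harmonic_lap => // x; rewrite /gball /= -natrM ltr_nat => cx.
  by apply: hu; lia.
move=> /(_ hu') le.
have inball x : (d c x <= e)%N -> gball G c e.+1%:R x.
  by move=> cx; rewrite /gball /= ltr_nat.
rewrite -lee_fin; apply: (le_trans (y := ereal_sup [set (u y)%:E | y in gball G c e.+1%:R])).
  by apply: ereal_sup_ubound; exists a => //; apply: inball.
apply: le_trans le _; rewrite EFinM lee_pmul2l ?lte_fin ?(lt_trans ltr01)//.
by apply: ereal_inf_lbound; exists b => //; apply: inball.
Qed.

(** Harnack is applied in steps of length at most [e] along a geodesic, so harmonicity is needed
    only within [3 * e] of vertices on geodesics. *)
Lemma harnack_chain H k e u a b : harnack_const H -> 0 <= H -> (0 < e)%N ->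
  (forall x, 0 <= u x) -> (d a b <= k * e)%N ->
  (forall c x, (d a c + d c b = d a b)%N -> (d c x <= 3 * e)%N -> lap u x = 0) ->
  u a <= H ^+ k * u b.
Proof.
move=> hH H0 e0 u0; elim: k a => [|k IH] a ab hu.
  by rewrite expr0 mul1r (@gdist0_eq _ _ G a b)//; lia.
have [c [ac cb]] := @gdist_split _ _ G (minn e (d a b)) a b (geq_minr _ _).
rewrite exprS -mulrA; apply: (le_trans (y := H * u c)).
  apply: (hH a e) => //; rewrite ?gdistxx// ?ac ?geq_minl//.
  by move=> x; apply: hu; rewrite gdistxx.
rewrite ler_wpM2l//; apply: IH; first lia.
move=> c' x e1; apply: hu.
have := gdist_triangle G c a c'; have := gdist_triangle G c' a b; lia.
Qed.

Lemma geodesic_chain (t : R) u a b : 0 <= t ->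
  (forall c c', adj G c c' -> (d a c + 1 + d c' b = d a b)%N -> t * u c' <= u c) ->
  t ^+ d a b * u b <= u a.
Proof.
move=> t0; have [n en] : exists n, n = d a b by exists (d a b).
rewrite -en; elim: n a en => [|n IH] a en step.
  by rewrite expr0 mul1r (@gdist0_eq _ _ G a b).
have [c [ac cb]] : exists c, d a c = 1%N /\ (d a c + d c b = d a b)%N.
  by apply: gdist_split; rewrite -en.
apply: (le_trans (y := t * u c)).
  rewrite exprS -mulrA ler_wpM2l//; apply: IH; first lia.
  move=> c1 c2 adj12 e12; apply: step => //.
  have := gdist_triangle G c a c1; have := gdist_triangle G c1 a b.
  by have := gdist_triangle G c2 c1 b; have := gdist_adj adj12; lia.
by apply: step; [exact: gdist1_adj|rewrite gdistxx; lia].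
Qed.

(** Superharmonicity at [a] puts [u a] above the average over the neighbours, in which [b] has
    weight at least [p0]. *)
Lemma superharmonic_step (p0 : R) u a b :
  (forall x y, adj G x y -> p0 <= wt G x y / vmeas G x) ->
  (forall x, 0 <= u x) -> 0 <= lap u a -> adj G a b -> p0 * u b <= u a.
Proof.
move=> hp u0 la ab; have m0 := vmeas_gt0 hp0 a.
apply: (le_trans (y := wt G a b / vmeas G a * u b)); first by rewrite ler_wpM2r// hp.
rewrite mulrAC ler_pdivrMr// [leRHS]mulrC.
apply: (le_trans (y := \sum_(y <- nbrs G a) wt G a y * u y)); last first.
  by rewrite -subr_ge0 -lapE.
rewrite (big_rem b) ?mem_nbrs//= lerDl; apply: sumr_ge0 => y _.
by rewrite mulr_ge0 ?wt_ge0.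
Qed.

Lemma superharmonic_chain (p0 : R) u a b : 0 <= p0 ->
  (forall x y, adj G x y -> p0 <= wt G x y / vmeas G x) ->
  (forall x, 0 <= u x) ->
  (forall c, (d a c + d c b = d a b)%N -> 0 <= lap u c) ->
  p0 ^+ d a b * u b <= u a.
Proof.
move=> p0_ge0 hp u0 hu; apply: geodesic_chain => // c c' cc' e.
apply: superharmonic_step => //; apply: hu.
have := gdist_triangle G c a b; have := gdist_triangle G c' c b.
by have := gdist_adj cc'; lia.
Qed.

(* If [y] is not near a geodesic from [w] to [z] and [z] is not near a geodesic
   from [w] to [y], symmetry gives
   [g w y = g y w <~ g y z = g z y <~ g z w = g w z], each step by a Harnack chain
   whose pole is off the geodesic; otherwise one chain with pole [w] suffices. *)
Lemma green_annulus H (U : {fset V}) w y z e n :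
  harnack_const H -> 1 <= H -> (0 < e)%N ->
  (forall x, (d w x <= (n + 6) * e)%N -> x \in U) ->
  (7 * e <= d w y <= n * e)%N -> (7 * e <= d w z <= n * e)%N ->
  green U w y <= H ^+ (2 * n + 3) * green U w z.
Proof.
move=> hH H1 e0 inU /andP[wy1 wy2] /andP[wz1 wz2].
have H0 : 0 <= H by apply: le_trans H1.
have g0 p x : 0 <= green U p x by exact: green_ge0.
have yU : y \in U by apply: inU; lia.
have zU : z \in U by apply: inU; lia.
have wU : w \in U by apply: inU; rewrite gdistxx; lia.
(* The three cases below use [3 + n], [n + 3] and [n + n] Harnack steps. *)
have powH k : (k <= 2 * n + 3)%N -> H ^+ k * green U w z <= H ^+ (2 * n + 3) * green U w z.
  by move=> kn; rewrite ler_wpM2r// ler_weXn2l.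
have harm p c x : (3 * e < d p c)%N -> (d w c <= (n + 3) * e)%N ->
    (d c x <= 3 * e)%N -> lap (green U p) x = 0.
  move=> pc wc cx; rewrite lap_green.
    by case: eqP => // xp; move: cx; rewrite xp gdistC; lia.
  by apply: inU; have := gdist_triangle G c w x; lia.
have [[c [wcz cy]]|far_y] :=
    pselect (exists c, (d w c + d c z = d w z)%N /\ (d c y <= 3 * e)%N).
  (* Detour through [c]: three steps from [y] to [c], then [n] to [z]. As [y] and [z] are at least
     [7 * e] from the pole, the chain stays at least [4 * e] from it. *)
  apply: le_trans (powH (3 + n)%N _); last lia.
  rewrite exprD -mulrA; apply: (le_trans (y := H ^+ 3 * green U w c)).
    apply: (harnack_chain (e := e)) => //; first by rewrite gdistC.
    move=> c' x e1; rewrite (gdistC G y c) in e1; apply: harm.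
      by have := gdist_triangle G c' w y; rewrite (gdistC G c' y); lia.
    by have := gdist_triangle G c w c'; rewrite (gdistC G c c'); lia.
  rewrite ler_wpM2l ?exprn_ge0//; apply: (harnack_chain (e := e)) => //; first lia.
  have wc := gdist_triangle G c w y.
  move=> c' x e1; apply: harm.
    have := gdist_triangle G c' w z; lia.
  have := gdist_triangle G c w c'; lia.
have [[c [wcy cz]]|far_z] :=
    pselect (exists c, (d w c + d c y = d w y)%N /\ (d c z <= 3 * e)%N).
  apply: le_trans (powH (n + 3)%N _); last lia.
  rewrite exprD -mulrA; apply: (le_trans (y := H ^+ n * green U w c)).
    apply: (harnack_chain (e := e)) => //; first by rewrite gdistC; lia.
    rewrite (gdistC G y c); have wc := gdist_triangle G c w z.
    move=> c' x; rewrite (gdistC G y c') => e1; apply: harm.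
      have := gdist_triangle G c' w y; lia.
    have := gdist_triangle G c w c'; rewrite (gdistC G c c'); lia.
  rewrite ler_wpM2l ?exprn_ge0//; apply: (harnack_chain (e := e)) => //.
  have wc := gdist_triangle G c w z.
  move=> c' x e1; apply: harm.
    by have := gdist_triangle G c' w z; lia.
  by have := gdist_triangle G c w c'; lia.
apply: le_trans (powH (n + n)%N _); last lia.
rewrite exprD -mulrA green_sym//; apply: (le_trans (y := H ^+ n * green U y z)).
  apply: (harnack_chain (e := e)) => // c x e1; apply: harm; last lia.
  by rewrite ltnNge gdistC; apply/negP => cy; apply: far_y; exists c.
rewrite ler_wpM2l ?exprn_ge0// green_sym// [leRHS]mulrC (green_sym hp0 wU zU) mulrC.
apply: (harnack_chain (e := e)) => //; first by rewrite gdistC.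
move=> c x; rewrite (gdistC G y c) (gdistC G c w) (gdistC G y w) => e1.
apply: harm; last lia.
rewrite ltnNge gdistC; apply/negP => cz; apply: far_z; exists c; split=> //; lia.
Qed.

End Harnack.

(** * Capacities of balls *)

Section Balls.
Context {R : realType} {V : countType} (G : weighted_graph R V).
Context (hp0 : cond_p0 G).
Implicit Types (a b c w x y z : V) (u : V -> R) (r s : R) (e k n : nat).
Local Notation d := (gdist G).
Local Notation lap := (lap G).
Local Notation green := (green hp0).
Local Notation capacity := (capacity hp0).
Local Notation equil := (equil hp0).

Definition fball x r : {fset V} := fset_set (gball G x r).

Lemma mem_fball x r y : (y \in fball x r) = ((d x y)%:R < r).
Proof. by rewrite in_fset_set ?mem_setE//; apply: gball_finite. Qed.

Lemma center_fball x r : 0 < r -> x \in fball x r.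
Proof. by rewrite mem_fball gdistxx. Qed.

Lemma fball_sub x r s : r <= s -> (fball x r `<=` fball x s)%fset.
Proof. by move=> rs; apply/fsubsetP => y; rewrite !mem_fball => /lt_le_trans; apply. Qed.

Lemma rho_capacity x r s : 0 < r -> r <= s ->
  rho G x r s = ((capacity (fball x r) (fball x s))^-1)%:E.
Proof.
move=> r0 rs; rewrite -(resistance_capacity hp0 (fball_sub x rs) (center_fball x r0)).
by rewrite /rho /fball !fset_setK//; apply: gball_finite.
Qed.

Lemma inner_boundary_fball x r y : inner_boundary G (fball x r) y ->
  (d x y)%:R < r /\ r <= (d x y)%:R + 1.
Proof.
case; rewrite mem_fball => yr [z yz]; rewrite mem_fball -leNgt => rz; split=> //.
apply: le_trans rz _; rewrite natr1 ler_nat.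
by have := gdist_triangle G y x z; have := gdist_adj yz; lia.
Qed.

Lemma p0_le1 (p0 : R) : (forall x y, adj G x y -> p0 <= wt G x y / vmeas G x) ->
  p0 <= 1.
Proof.
have [x _] : exists x : V, True.
  apply: contrapT => no; apply: (vertices_infinite G).
  by rewrite (_ : setT = set0) // -subset0 => x _; apply: no; exists x.
move=> hp; have [y xy] := exists_adj hp0 x; apply: le_trans (hp _ _ xy) _.
by rewrite ler_pdivrMr ?vmeas_gt0// mul1r wt_le_vmeas.
Qed.

(** Here [e] is the integer part of [r / 16]; since [256 = 16 * 16], the rounding error, below [16],
    is absorbed by one further [e]. *)
Lemma large_radius r : 256 <= r ->
  exists e, [/\ (16 <= e)%N, 16 * e%:R <= r & r < 17 * e%:R].
Proof.
move=> r256; exists (Num.truncn (r / 16)).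
have r0 : 0 <= r / 16 by lra.
have /andP[h1 h2] := truncn_itv r0.
have e16 : (16 <= Num.truncn (r / 16))%N by rewrite truncn_ge_nat//; lra.
move: (Num.truncn _) h1 h2 e16 => e h1 h2 e16.
have {}h1 : e%:R * 16 <= r by rewrite -ler_pdivlMr.
have {}h2 : r < (e%:R + 1) * 16 by rewrite -ltr_pdivrMr// natr1.
have e16' : 16 <= e%:R :> R by rewrite (ler_nat R 16 e).
by split=> //; lra.
Qed.

(** On the boundary of the larger ball, [C] times the Green function dominates its values on that of
    the smaller one. Its integral against each equilibrium measure is [1], so the total masses
    compare in the opposite order. *)
Lemma capacity_green_compare x r s t (C : R) : 0 < r -> r <= s -> s <= t -> 0 < C ->
  (forall y z, inner_boundary G (fball x r) y -> inner_boundary G (fball x s) z ->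
     green (fball x t) x y <= C * green (fball x t) x z) ->
  capacity (fball x s) (fball x t) <= C * capacity (fball x r) (fball x t).
Proof.
move=> r0 rs st C0 hC; have rt := le_trans rs st.
have xr := center_fball x r0; have xs := center_fball x (lt_le_trans r0 rs).
have c0 := capacity_gt0 hp0 (fball_sub x rt) xr.
have k0 : 0 < C * capacity (fball x r) (fball x t) by rewrite mulr_gt0.
rewrite -[leRHS]mulr1 -ler_pdivrMl//.
apply: (green_capacity_le1 (fball_sub x st) xs) => z zb.
rewrite -div1r ler_pdivrMr// mulrCA mulrA.
by apply: (green_capacity_ge1 (fball_sub x rt) xr) => y yb; apply: hC.
Qed.

(** The comparison passes through the pole, from [y] to [x] and on to [z], at a factor [p0] per
    edge. The Green function is superharmonic on all of [D], pole included. *)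
Lemma green_compare_near n : exists2 A : R, 1 <= A & forall (D : {fset V}) x y z,
  (forall c, (d x c <= maxn (d x y) (d x z))%N -> c \in D) ->
  (d x y <= n)%N -> (d x z <= n)%N ->
  green D x y <= A * green D x z.
Proof.
have [p0 p0_gt0 hp] := hp0; have p0_ge0 := ltW p0_gt0.
have p1 := p0_le1 hp.
exists (p0 ^- (n + n)) => [|D x y z inD xy xz].
  by rewrite invf_ge1 ?exprn_gt0// exprn_ile1.
have g0 c : 0 <= green D x c by apply: green_ge0.
have lg c : (d x c <= maxn (d x y) (d x z))%N -> 0 <= lap (green D x) c.
  by move=> /inD cD; rewrite lap_green.
rewrite ler_pdivlMl ?exprn_gt0//.
apply: (le_trans (y := p0 ^+ d z x * (p0 ^+ d x y * green D x y))).
  by rewrite mulrA -exprD ler_wpM2r// ler_wiXn2l// (gdistC G z x); lia.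
apply: (le_trans (y := p0 ^+ d z x * green D x x)).
  rewrite ler_wpM2l ?exprn_ge0//.
  by apply: (superharmonic_chain hp0) => // c e; apply: lg; lia.
apply: (superharmonic_chain hp0) => // c; rewrite (gdistC G z x) (gdistC G c x) => e.
by apply: lg; lia.
Qed.

Lemma capacity_double_inner (H : R) : 1 < H -> harnack_const G H ->
  exists2 C : R, 1 < C & forall x r, 0 < r ->
    capacity (fball x (2 * r)) (fball x (4 * r)) <=
    C * capacity (fball x r) (fball x (4 * r)).
Proof.
move=> H1 hH.
(* [512 = 2 * 256] bounds [2 * r] for small radii. For large ones [2 * r < 34 * e], and
   [green_annulus] with [n = 34] gives the exponent [71 = 2 * 34 + 3]. *)
have [A A1 hA] := green_compare_near 512.
have [B BE] : exists B, B = H ^+ 71 by eexists.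
have B1 : 1 <= B by rewrite BE exprn_ege1// ltW.
exists (A + B) => [|x r r0]; first lra.
apply: capacity_green_compare => //; try lra.
set g := green (fball x (4 * r)) x.
have g0 z : 0 <= g z by apply: green_ge0.
move=> y z /inner_boundary_fball [y1 y2] /inner_boundary_fball [z1 z2].
case: (ltP r 256) => [small|large].
  apply: (le_trans (y := A * g z)); last by rewrite ler_wpM2r//; lra.
  apply: hA => [c||]; try by rewrite -(ler_nat R); lra.
  by rewrite mem_fball leq_max -!(ler_nat R) => /orP[]; lra.
have [e [e16 re1 re2]] := large_radius large.
have e16' : 16 <= e%:R :> R by rewrite (ler_nat R 16 e).
apply: (le_trans (y := B * g z)); last by rewrite ler_wpM2r//; lra.
rewrite BE; apply: (green_annulus hp0 (n := 34) (e := e)) => //; first exact: ltW.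
- exact: leq_trans e16.
- by move=> c; rewrite mem_fball -(ler_nat R) natrM; lra.
- by apply/andP; split; rewrite -(ler_nat R) natrM; lra.
- by apply/andP; split; rewrite -(ler_nat R) natrM; lra.
Qed.

(* [escape x r z] is the probability that the walk from [z], after leaving
   [B(x,2r)], leaves [B(x,4r)] before hitting [B(x,r)]. *)
Definition escape x r := dirichlet_sol hp0 (fball x (2 * r))
  (fun z => 1 - equil (fball x r) (fball x (4 * r)) z) (fun=> 0).

Lemma lap_escape x r z : z \in fball x (2 * r) -> lap (escape x r) z = 0.
Proof. exact: lap_dirichlet_sol. Qed.

Lemma escape_out x r z : z \notin fball x (2 * r) ->
  escape x r z = 1 - equil (fball x r) (fball x (4 * r)) z.
Proof. exact: dirichlet_sol_out. Qed.

(** The left side is subharmonic in [B(x,2r)], since [lap] of [equil] is non-negative on [B(x,r)]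
    and zero on the rest; [escape] is harmonic there with the same values outside. *)
Lemma escape_ge x r z : 0 < r ->
  1 - equil (fball x r) (fball x (4 * r)) z <= escape x r z.
Proof.
move=> r0; apply: (comparison hp0 (D := fball x (2 * r))
  (u := fun y => 1 - equil (fball x r) (fball x (4 * r)) y)) => y yD.
  rewrite lap_compl lap_escape// oppr_le0.
  have [yX|yX] := boolP (y \in fball x r); first exact: lap_equil_ge0.
  by rewrite equil_lap0//; apply: (fsubsetP (fball_sub _ _)) yD; lra.
by rewrite escape_out.
Qed.

Lemma escape_ge0 x r z : 0 < r -> 0 <= escape x r z.
Proof.
by move=> r0; apply: le_trans (escape_ge _ _ r0); rewrite subr_ge0 equil_le1.
Qed.

(** Go from [a] to [x], then along a geodesic to a vertex at distance [n], where [escape] is [1]: at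
    most [2 * n] edges, each costing a factor [p0]. *)
Lemma escape_near n : exists2 A : R, 1 <= A & forall x r a, 0 < r ->
  4 * r <= n%:R -> a \in fball x r -> 1 <= A * escape x r a.
Proof.
have [p0 p0_gt0 hp] := hp0; have p0_ge0 := ltW p0_gt0.
have p1 := p0_le1 hp.
exists (p0 ^- (n + n)) => [|x r a r0 rn].
  by rewrite invf_ge1 ?exprn_gt0// exprn_ile1.
rewrite mem_fball => ar; set u := escape x r.
have u0 z : 0 <= u z by apply: escape_ge0.
have ua : p0 ^+ d a x * u x <= u a.
  apply: (superharmonic_chain hp0) => // c; rewrite (gdistC G a x) (gdistC G a c) => e.
  rewrite lap_escape// mem_fball.
  have : (d x c <= d x a)%N by rewrite (gdistC G x c); lia.
  by rewrite -(ler_nat R); lra.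
have [y xy] := exists_gdist hp0 x n.
have yD : y \notin fball x (4 * r) by rewrite mem_fball xy -leNgt.
have uy : u y = 1.
  rewrite /u escape_out ?equil0 ?subr0//; first by apply: fball_sub; lra.
  by apply: contra yD; apply/fsubsetP/fball_sub; lra.
have ux : p0 ^+ d x y * u y <= u x.
  (* Three regimes: [u] is harmonic in [B(x,2r)]; from there up to [B(x,4r)] it equals the harmonic
     [1 - equil]; beyond, [u c = 1] and [u c'] is at most [1]. Distances from [x] grow along the
     geodesic, so [c'] stays outside [B(x,2r)] once [c] is. *)
  apply: geodesic_chain => // c c' cc' e.
  have [cD'|cD'] := boolP (c \in fball x (2 * r)).
    by apply: superharmonic_step cc' => //; rewrite lap_escape.
  have c'D' : c' \notin fball x (2 * r).
    move: cD'; rewrite !mem_fball -!leNgt => cD'; apply: le_trans cD' _.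
    by rewrite ler_nat; have := gdist_triangle G c' x y; lia.
  rewrite /u !escape_out//; have [cD|cD] := boolP (c \in fball x (4 * r)).
    pose v z := 1 - equil (fball x r) (fball x (4 * r)) z.
    apply: (superharmonic_step hp0 (u := v)) cc' => //.
      by move=> z; rewrite subr_ge0 equil_le1.
    rewrite lap_compl equil_lap0 ?oppr0//.
    by apply: contra cD'; apply/fsubsetP/fball_sub; lra.
  rewrite [X in _ <= 1 - X]equil0 ?subr0//; last by apply: fball_sub; lra.
  have e0 := equil_ge0 hp0 (fball x r) (fball x (4 * r)) c'.
  have e1 := equil_le1 hp0 (fball x r) (fball x (4 * r)) c'.
  by rewrite mulr_ile1 ?subr_ge0//; lra.
rewrite ler_pdivlMl ?exprn_gt0// mulr1.
apply: le_trans ua; apply: (le_trans (y := p0 ^+ d a x * p0 ^+ d x y)).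
  rewrite -exprD ler_wiXn2l// xy leq_add2r -(ler_nat R) gdistC; lra.
by rewrite ler_wpM2l ?exprn_ge0//; move: ux; rewrite uy mulr1.
Qed.

End Balls.

(** * Escape probabilities at large radii and the second capacity bound *)

Section Escape.
Context {R : realType} {V : countType} (G : weighted_graph R V).
Context (hp0 : cond_p0 G).
Implicit Types (a b c m w x y z : V) (u : V -> R) (r s : R) (e k n : nat).
Local Notation d := (gdist G).
Local Notation lap := (lap G).
Local Notation green := (green hp0).
Local Notation capacity := (capacity hp0).
Local Notation equil := (equil hp0).
Local Notation fball := (fball G).

Lemma green_pole_gt0 (D : {fset V}) p : p \in D -> 0 < green D p p.
Proof.
move=> pD.
have e1 : vmeas G p * green D p p - \sum_(y <- nbrs G p) wt G p y * green D p y = 1.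
  by rewrite -lapE// lap_green// eqxx.
have s0 : 0 <= \sum_(y <- nbrs G p) wt G p y * green D p y.
  by apply: sumr_ge0 => y _; rewrite mulr_ge0 ?wt_ge0 ?green_ge0.
have : 0 < vmeas G p * green D p p by lra.
by rewrite pmulr_rgt0 ?vmeas_gt0.
Qed.

(* A pole [w] is placed at distance [120 e] from [x], and
   [g = green U w] with [U] a large ball minus [B(x,r)].  By the annulus
   inequality and a Harnack chain, the maximum of [g] away from [w] is at most a
   constant multiple of [g m], so [g m / max g] bounds the escape probability from
   [m] from below. *)
Lemma escape_point (H : R) : 1 < H -> harnack_const G H ->
  exists2 B : R, 1 <= B & forall x r e, (16 <= e)%N -> 16 * e%:R <= r -> r < 17 * e%:R ->
    exists2 m, d x m = (22 * e)%N &
      1 <= B * (1 - equil (fball x r) (fball x (4 * r)) m).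
Proof.
move=> H1 hH; have H0 : 0 <= H by apply: le_trans (ltW H1).
(* [19 = 2 * 8 + 3] comes from [green_annulus] on the sphere of radius [8 * e] about the pole; [90]
   is the number of Harnack steps from [m0] to [m]. *)
have [B1 B1E] : exists B, B = H ^+ 19 by eexists.
have [B2 B2E] : exists B, B = H ^+ 90 by eexists.
have B1_ge1 : 1 <= B1 by rewrite B1E exprn_ege1// ltW.
have B2_ge1 : 1 <= B2 by rewrite B2E exprn_ege1// ltW.
exists (B1 * B2) => [|x r e e16 re1 re2]; first by rewrite mulr_ege1.
have e0 : (0 < e)%N by apply: leq_trans e16.
have e16' : 16 <= e%:R :> R by rewrite (ler_nat R 16 e).
have r0 : 0 < r by lra.
have r4 : r <= 4 * r by lra.
(* The distances split as [120 = 8 + 90 + 22]. At [22 * e] from [x], the point [m] has its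
   [3 * e]-neighbourhood outside [B(x,r)], as [r < 17 * e], and inside [B(x,2r)], as
   [32 * e <= 2 * r]. *)
have [w xw] := exists_gdist hp0 x (120 * e).
have [m0 [wm0 wm0x]] : exists c, d w c = (8 * e)%N /\ (d w c + d c x = d w x)%N.
  by apply: gdist_split; rewrite gdistC xw; lia.
have m0x : d m0 x = (112 * e)%N by rewrite (gdistC G w x) xw in wm0x; lia.
have [m [m0m m0mx]] : exists c, d m0 c = (90 * e)%N /\ (d m0 c + d c x = d m0 x)%N.
  by apply: gdist_split; rewrite m0x; lia.
have xm : d x m = (22 * e)%N by rewrite gdistC; lia.
exists m => //.
set X := fball x r; set D := fball x (4 * r).
have inX c : c \in X -> (d x c < 17 * e)%N.
  by rewrite mem_fball// -(ltr_nat R) natrM; lra.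
pose W := fset_set [set y | (d x y <= 1000 * e)%N].
have memW c : (c \in W) = (d x c <= 1000 * e)%N.
  by rewrite in_fset_set ?mem_setE//; apply: nball_finite.
pose U := (W `\` X)%fset.
have UX c : (d x c <= 1000 * e)%N -> c \notin X -> c \in U.
  by move=> c1 cX; rewrite in_fsetD memW c1 cX.
have inU c : (d x c <= 1000 * e)%N -> (17 * e <= d x c)%N -> c \in U.
  move=> c1 c2; apply: UX => //.
  by apply: contraL c2 => cX; rewrite -ltnNge inX.
have XU c : c \in X -> c \notin U by rewrite in_fsetD => ->.
set g := green U w.
have g0 c : 0 <= g c by apply: green_ge0.
have lg c : c \in U -> c != w -> lap g c = 0.
  by move=> cU /negPf cw; rewrite /g lap_green// cw.
have step1 y : d w y = (8 * e)%N -> g y <= B1 * g m0.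
  move=> wy; rewrite B1E; apply: (green_annulus hp0 (n := 8) (e := e)) => //.
  - exact: ltW.
  - move=> c wc; have := gdist_triangle G c x w; rewrite (gdistC G c w) xw => t1.
    have := gdist_triangle G w x c; rewrite xw => t2.
    by apply: inU; move: wc t1 t2; clear; lia.
  - by rewrite wy leqnn andbT leq_mul2r orbT.
  - by rewrite wm0 leqnn andbT leq_mul2r orbT.
have step2 : g m0 <= B2 * g m.
  rewrite B2E; apply: (harnack_chain (e := e) hH) => //; first by rewrite m0m.
  move=> c z mcm cz.
  have xc1 : (d x c <= 112 * e)%N.
    have := gdist_triangle G m x c; rewrite (gdistC G m c) xm.
    by move: mcm; rewrite m0m; clear; lia.
  have xc2 : (22 * e <= d x c)%N.
    have := gdist_triangle G c m0 x; rewrite (gdistC G c x) m0x.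
    by move: mcm; rewrite m0m; clear; lia.
  apply: lg.
    have := gdist_triangle G c x z; have := gdist_triangle G z x c.
    rewrite (gdistC G z c) => t1 t2.
    by apply: inU; move: xc1 xc2 cz t1 t2; clear; lia.
  apply: contraTneq cz => ->; rewrite -ltnNge.
  by have := gdist_triangle G c x w; rewrite xw; move: xc1 e0; clear; lia.
pose M := B1 * B2 * g m.
have gM1 y : d w y = (8 * e)%N -> g y <= M.
  move=> /step1 /le_trans; apply; rewrite /M -mulrA ler_wpM2l//; lra.
have M0 : 0 <= M by rewrite /M !mulr_ge0//; lra.
have gM y : (8 * e < d w y)%N -> g y <= M.
  move=> wy; have [yU|yU] := boolP (y \in U); last by rewrite /g green0.
  (* Maximum principle away from the pole: a neighbour of [A] outside [A] either lies off [U], where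
     [g] is [0], or is at distance exactly [8 * e] from [w]. *)
  pose A := [fset z in U | (8 * e < d w z)%N]%fset.
  have memA z : (z \in A) = (z \in U) && (8 * e < d w z)%N by rewrite !inE.
  apply: (comparison_closure hp0 (D := A) (g := fun=> M)).
  - move=> z; rewrite memA => /andP[zU wz]; rewrite lap_const lg//.
    by apply/eqP => zw; move: wz; rewrite zw gdistxx.
  - move=> z t; rewrite !memA => /andP[zU wz] zt; rewrite negb_and => /orP[tU|wt].
      by rewrite /g green0.
    apply: gM1; have := gdist_triangle G t w z; rewrite (gdistC G t z).
    by have := gdist_adj zt; move: wz wt; clear; lia.
  - by rewrite memA yU.
(* Needed for the final division by [g m]. Since [d m w] is at most [98 * e], geodesics from [m] to
   [w] stay at least [22 * e] from [x], hence inside [U]. *)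
have gm0 : 0 < g m.
  have wU : w \in U by apply: inU; rewrite xw leq_mul2r orbT.
  have [p0 p0_gt0 hp] := hp0.
  have : 0 < p0 ^+ d m w * g w by rewrite mulr_gt0 ?exprn_gt0 ?green_pole_gt0.
  move=> /lt_le_trans; apply; apply: (superharmonic_chain hp0); rewrite ?(ltW p0_gt0)//.
  move=> c mcw; have := gdist_triangle G m0 m w; rewrite (gdistC G m m0) (gdistC G m0 w).
  have t1 := gdist_triangle G c x w; have t2 := gdist_triangle G m x c.
  move=> t3; rewrite /g lap_green//; apply: inU; move: mcw t1 t2 t3.
    by rewrite xm m0m wm0 xw; clear; lia.
  by rewrite xm m0m wm0 xw; clear; lia.
pose v z := 1 - equil X D z.
have XD : (X `<=` D)%fset by apply: fball_sub.
have v0 z : 0 <= v z by rewrite subr_ge0 equil_le1.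
have inD z : z \in D -> (d x z < 68 * e)%N.
  by rewrite mem_fball// -(ltr_nat R) natrM; lra.
(* Both sides are harmonic between [X] and the complement of [D]. On [X] the left one is [0]; just
   outside [D] one has [v = 1], and [w] is far enough away for [gM]. *)
have gv z : z \in (D `\` X)%fset -> g z <= M * v z.
  apply: (comparison_closure hp0 (g := fun z => M * v z)) => {z}.
    move=> z; rewrite !inE => /andP[zX zD].
    rewrite lapZ lap_compl equil_lap0// oppr0 mulr0 lg//.
      by apply: UX => //; have := inD z zD; clear; lia.
    by apply/eqP => zw; have := inD z zD; rewrite zw xw; clear; lia.
  move=> z t; rewrite !inE => /andP[zX zD] zt; rewrite negb_and negbK => /orP[tX|tD].
    by rewrite /g green0 ?XU//; apply: mulr_ge0.
  rewrite /v equil0// subr0 mulr1; apply: gM.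
  have := inD z zD; have := gdist_adj zt; have := gdist_triangle G z x t.
  have := gdist_triangle G t x w; rewrite (gdistC G t w) xw; clear; lia.
have : g m <= M * v m.
  apply: gv; rewrite !inE !mem_fball// -!leNgt xm natrM.
  by apply/andP; split; lra.
rewrite /M -mulrA [g m * _]mulrC mulrA -[leLHS]mul1r ler_pM2r//.
Qed.


Lemma capacity_double_outer (H : R) : 1 < H -> harnack_const G H ->
  exists2 C : R, 1 < C & forall x r, 0 < r ->
    capacity (fball x r) (fball x (2 * r)) <= C * capacity (fball x r) (fball x (4 * r)).
Proof.
move=> H1 hH; have H0 : 0 <= H by apply: le_trans (ltW H1).
(* [1024 = 4 * 256] bounds [4 * r] for small radii. For large ones, [22] Harnack steps lead from [m]
   to [x] and [17] from [x] to [a]. *)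
have [A A1 hA] := escape_near hp0 1024.
have [B B1 hB] := escape_point H1 hH.
have [B2 B2E] : exists B, B = H ^+ 22 by eexists.
have [B3 B3E] : exists B, B = H ^+ 17 by eexists.
have B2_ge1 : 1 <= B2 by rewrite B2E exprn_ege1// ltW.
have B3_ge1 : 1 <= B3 by rewrite B3E exprn_ege1// ltW.
have B4_ge1 : 1 <= B * B2 * B3 by rewrite !mulr_ege1.
exists (A + B * B2 * B3) => [|x r r0]; first lra.
have r2 : r <= 2 * r by lra.
have r24 : 2 * r <= 4 * r by lra.
have C0 : 0 < A + B * B2 * B3 by lra.
rewrite -ler_pdivrMl//.
apply: (capacity_compare (u := escape hp0 x r)) => [||z|z|a aX].
- exact: fball_sub.
- exact: fball_sub.
- exact: escape_out.
- exact: lap_escape.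
set u := escape hp0 x r.
have u0 z : 0 <= u z by apply: escape_ge0.
rewrite -div1r ler_pdivrMr// mulrC.
case: (ltP r 256) => [small|large].
  apply: (le_trans (y := A * u a)); last by rewrite ler_wpM2r//; lra.
  by apply: hA => //; lra.
apply: (le_trans (y := B * B2 * B3 * u a)); last by rewrite ler_wpM2r//; lra.
have [e [e16 re1 re2]] := large_radius large.
have e0 : (0 < e)%N by apply: leq_trans e16.
have [m xm hm] := hB x r e e16 re1 re2.
apply: (le_trans hm); rewrite -2!mulrA ler_wpM2l//; first lra.
apply: (le_trans (escape_ge hp0 x m r0)); rewrite -/u.
(* Both chains stay within [22 * e] of [x], so their [3 * e]-neighbourhoods stay within [25 * e],
   inside [B(x,2r)]. *)
have lu c z : (d x c <= 22 * e)%N -> (d c z <= 3 * e)%N -> lap u z = 0.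
  move=> xc cz; rewrite /u lap_escape// mem_fball//.
  have xz : (d x z <= 25 * e)%N.
    by have := gdist_triangle G c x z; move: xc cz; clear; lia.
  have e1 : 1 <= e%:R :> R by rewrite ler1n.
  by move: xz; rewrite -(ler_nat R) natrM; lra.
apply: (le_trans (y := B2 * u x)).
  rewrite B2E; apply: (harnack_chain hH H0 e0) => //; first by rewrite gdistC xm.
  move=> c z mcx; apply: lu; move: mcx.
  by rewrite (gdistC G m x) xm (gdistC G c x); clear; lia.
rewrite ler_wpM2l//; first lra.
have xa : (d x a <= 17 * e)%N.
  by move: aX; rewrite mem_fball// -(ler_nat R) natrM; lra.
rewrite B3E; apply: (harnack_chain hH H0 e0) => // c z xca; apply: lu.
by move: xca xa; clear; lia.
Qed.

End Escape.

(** * From capacities back to resistances *)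

Section Resistance.
Context {R : realType} {V : countType} (G : weighted_graph R V).

Lemma rho_le_capacity (hp0 : cond_p0 G) x (r1 s1 r2 s2 C : R) :
  0 < r1 -> r1 <= s1 -> 0 < r2 -> r2 <= s2 ->
  capacity hp0 (fball G x r2) (fball G x s2) <=
    C * capacity hp0 (fball G x r1) (fball G x s1) ->
  (rho G x r1 s1 <= C%:E * rho G x r2 s2)%E.
Proof.
move=> r1_gt0 rs1 r2_gt0 rs2 le.
have c1 := capacity_gt0 hp0 (fball_sub hp0 x rs1) (center_fball hp0 x r1_gt0).
have c2 := capacity_gt0 hp0 (fball_sub hp0 x rs2) (center_fball hp0 x r2_gt0).
rewrite !(rho_capacity hp0)// -EFinM lee_fin ler_pdivlMr//.
by rewrite mulrC ler_pdivrMr.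
Qed.

End Resistance.

Theorem theorem4p6 (R : realType) (V : countType) (G : weighted_graph R V)
    (hp0 : cond_p0 G) (hH : elliptic_harnack G) :
  (exists2 C2 : R, 1 < C2 & forall (x : V) (r : R), 0 < r ->
     (rho G x r (4 * r) <= C2%:E * rho G x (2 * r) (4 * r))%E) /\
  (bounded_covering G ->
   exists2 C1 : R, 1 < C1 & forall (x : V) (r : R), 0 < r ->
     (rho G x r (4 * r) <= C1%:E * rho G x r (2 * r))%E).
Proof.
have [H H1 hHn] := elliptic_harnack_nat hp0 hH; split=> [|_].
  have [C C1 hC] := capacity_double_inner hp0 H1 hHn.
  exists C => // x r r0; apply: rho_le_capacity (hC x r r0); lra.
have [C C1 hC] := capacity_double_outer hp0 H1 hHn.
exists C => // x r r0; apply: rho_le_capacity (hC x r r0); lra.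
Qed.
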